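(* Let $A\in\mathbb{R}^{d\times d}$ be symmetric and let $b\in\mathbb{R}^d$ with $b\notin\mathrm{Range}(A)$. Let $g$ be the grade of $b$ with respect to $A$. Run the conjugate residual (CR) iteration on $(A,b)$ started at $x_0=0$, and suppose that no unlucky breakdown occurs. Then, for $1\le k\le g$, one has $A r_{k-1}=0$ if and only if $k=g$.
   Context: Krylov subspace: $\mathcal{K}_k(A,b)=\mathrm{Span}\{b,Ab,\dots,A^{k-1}b\}$, $k\ge 1$. The grade of $b$ with respect to $A$ is the positive integer $g$ with $\dim\mathcal{K}_k(A,b)=k$ for $k\le g$ and $\dim\mathcal{K}_k(A,b)=g$ for $k>g$. CR iteration (in exact arithmetic): $x_0=0$, $r_0=p_0=b$, and for $k=1,2,\dots$, as long as the denominators are nonzero: $\alpha_{k-1}=\langle r_{k-1},Ar_{k-1}\rangle/\|Ap_{k-1}\|^2$, $x_k=x_{k-1}+\alpha_{k-1}p_{k-1}$, $r_k=r_{k-1}-\alpha_{k-1}Ap_{k-1}$, $\beta_{k-1}=\langle r_k,Ar_k\rangle/\langle r_{k-1},Ar_{k-1}\rangle$, $p_k=r_k+\beta_{k-1}p_{k-1}$. No unlucky breakdown (for CR): if $A$ is indefinite, then no generated residual $r_{k-1}$ is a zero-curvature direction, i.e. there is no generated nonzero $r_{k-1}\notin\mathrm{Null}(A)$ with $\langle r_{k-1},Ar_{k-1}\rangle=0$. *)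

(* Defs.v *)
From HB Require Import structures.
From mathcomp Require Import all_boot all_order all_algebra.
From mathcomp Require Import reals.

Set Implicit Arguments.
Unset Strict Implicit.
Unset Printing Implicit Defensive.

Import Order.TTheory GRing.Theory Num.Theory.
Local Open Scope ring_scope.

Definition dot (R : realType) (d : nat) (u v : 'cV[R]_d) : R :=
  \sum_(i < d) u i 0 * v i 0.

(* The norm that MathComp-Analysis puts on matrices is the max norm; the
   Euclidean norm is needed here. *)
Definition enorm (R : realType) (d : nat) (u : 'cV[R]_d) : R :=
  Num.sqrt (dot u u).

Definition in_range (R : realType) (d : nat) (A : 'M[R]_d) (b : 'cV[R]_d) :
  Prop := exists x : 'cV[R]_d, A *m x = b.

Definition in_null (R : realType) (d : nat) (A : 'M[R]_d) (v : 'cV[R]_d) :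
  Prop := A *m v = 0.

Definition indefinite (R : realType) (d : nat) (A : 'M[R]_d) : Prop :=
  (exists u : 'cV[R]_d, 0 < dot u (A *m u)) /\
  (exists v : 'cV[R]_d, dot v (A *m v) < 0).

Definition krylov (R : realType) (d : nat) (A : 'M[R]_d) (b : 'cV[R]_d)
  (k : nat) : {vspace 'cV[R]_d} :=
  <<[seq A ^+ i *m b | i <- iota 0 k]>>%VS.

Definition is_grade (R : realType) (d : nat) (A : 'M[R]_d) (b : 'cV[R]_d)
  (g : nat) : Prop :=
  [/\ (0 < g)%N,
      forall k : nat, (1 <= k <= g)%N -> \dim (krylov A b k) = k
    & forall k : nat, (g < k)%N -> \dim (krylov A b k) = g].

Record cr_state (R : realType) (d : nat) := CRState {
  cr_x : 'cV[R]_d;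
  cr_r : 'cV[R]_d;
  cr_p : 'cV[R]_d
}.

Definition cr_init (R : realType) (d : nat) (b : 'cV[R]_d) : cr_state R d :=
  CRState 0 b b.

Definition cr_step (R : realType) (d : nat) (A : 'M[R]_d) (s : cr_state R d) :
  cr_state R d :=
  let: CRState x r p := s in
  let alpha := dot r (A *m r) / enorm (A *m p) ^+ 2 in
  let x' := x + alpha *: p in
  let r' := r - alpha *: (A *m p) in
  let beta := dot r' (A *m r') / dot r (A *m r) in
  let p' := r' + beta *: p in
  CRState x' r' p'.

(* Total, since division by zero returns 0: the k-th state is meaningful only
   under [cr_generated A b k]. *)
Definition cr (R : realType) (d : nat) (A : 'M[R]_d) (b : 'cV[R]_d) (k : nat) :
  cr_state R d := iter k (cr_step A) (cr_init b).

(* The denominators of alpha and beta are nonzero in each of the k steps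
   leading to the k-th state. *)
Definition cr_generated (R : realType) (d : nat) (A : 'M[R]_d) (b : 'cV[R]_d)
  (k : nat) : Prop :=
  forall j : nat, (j < k)%N ->
    enorm (A *m cr_p (cr A b j)) ^+ 2 <> 0 /\
    dot (cr_r (cr A b j)) (A *m cr_r (cr A b j)) <> 0.

Definition no_unlucky_breakdown (R : realType) (d : nat) (A : 'M[R]_d)
  (b : 'cV[R]_d) : Prop :=
  indefinite A ->
  ~ exists k : nat,
      [/\ cr_generated A b k,
          cr_r (cr A b k) <> 0,
          ~ in_null A (cr_r (cr A b k))
        & dot (cr_r (cr A b k)) (A *m cr_r (cr A b k)) = 0].

(* Main.v *)
Require Import Defs.
From HB Require Import structures.
From mathcomp Require Import all_boot all_order all_algebra.
From mathcomp Require Import reals.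
From mathcomp Require Import boolp ring.

Set Implicit Arguments.
Unset Strict Implicit.
Unset Printing Implicit Defensive.

Import Order.TTheory GRing.Theory Num.Theory.
Local Open Scope ring_scope.

(** Write [K_k] for the Krylov space of [(A, b)] and [V] for
    [A K_(g-1) = Span {A b, ..., A^(g-1) b}].

    The residual is always [r_j = b - A x_j] with [x_j] in [K_j], that is, a
    polynomial in [A] with constant coefficient 1, applied to [b]
    ([cr_krylov]). If [A r_j = 0], then [A b] is a combination of
    [A^2 b, ..., A^(j+1) b], so that [K_(j+2)] has dimension at most [j+1];
    this is impossible when [j+2 <= g] ([cr_residual_neq0]).

    Hence [A r_j <> 0] before the last step, and the iteration does reach
    index [g-1]. Indeed [<r_j, A r_j> = 0] with [A r_j <> 0] is an unlucky
    breakdown if [A] is indefinite, and cannot happen if [A] is semidefinite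
    ([not_indefinite_dot_eq0]); moreover [<r_j, A p_j> = <r_j, A r_j>], so that
    [A p_j] does not vanish either.

    At index [g-1] two facts meet. On the one hand, [b] not in the range of [A]
    forces [A K_g] into [V]: writing [A^g b] as [c b + v] with [v] in [V], a
    nonzero [c] would put [b] in the range ([krylov_stationary_range]). Thus [V]
    is stable under [A] and contains [A r_(g-1)], hence [A^2 r_(g-1)] too. On the
    other hand, the conjugacy relations ([cr_orthogonality]), together with
    the fact that the search directions span the Krylov spaces
    ([krylov_directions]), make [r_(g-1)] orthogonal to [V]. Therefore
    [|A r_(g-1)|^2 = <r_(g-1), A^2 r_(g-1)> = 0] ([cr_residual_eq0]). *)

(** * The Euclidean inner product and semidefinite matrices *)

Lemma dotE (R : realType) (d : nat) (u v : 'cV[R]_d) :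
  dot u v = (u^T *m v) 0 0.
Proof. by rewrite mxE; apply: eq_bigr => i _; rewrite mxE. Qed.

Lemma dotC (R : realType) (d : nat) (u v : 'cV[R]_d) : dot u v = dot v u.
Proof. by apply: eq_bigr => i _; rewrite mulrC. Qed.

Lemma dotDr (R : realType) (d : nat) (u v w : 'cV[R]_d) :
  dot u (v + w) = dot u v + dot u w.
Proof. by rewrite !dotE mulmxDr mxE. Qed.

Lemma dotZr (R : realType) (d : nat) a (u v : 'cV[R]_d) :
  dot u (a *: v) = a * dot u v.
Proof. by rewrite !dotE -scalemxAr mxE. Qed.

Lemma dotNr (R : realType) (d : nat) (u v : 'cV[R]_d) :
  dot u (- v) = - dot u v.
Proof. by rewrite -scaleN1r dotZr mulN1r. Qed.

Lemma dotBr (R : realType) (d : nat) (u v w : 'cV[R]_d) :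
  dot u (v - w) = dot u v - dot u w.
Proof. by rewrite dotDr dotNr. Qed.

Lemma dotDl (R : realType) (d : nat) (u v w : 'cV[R]_d) :
  dot (u + v) w = dot u w + dot v w.
Proof. by rewrite dotC dotDr !(dotC w). Qed.

Lemma dotBl (R : realType) (d : nat) (u v w : 'cV[R]_d) :
  dot (u - v) w = dot u w - dot v w.
Proof. by rewrite dotC dotBr !(dotC w). Qed.

Lemma dotZl (R : realType) (d : nat) a (u v : 'cV[R]_d) :
  dot (a *: u) v = a * dot u v.
Proof. by rewrite dotC dotZr dotC. Qed.

Lemma dot0r (R : realType) (d : nat) (u : 'cV[R]_d) : dot u 0 = 0.
Proof. by rewrite dotE mulmx0 mxE. Qed.

Lemma dot_ge0 (R : realType) (d : nat) (u : 'cV[R]_d) : 0 <= dot u u.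
Proof. by apply: sumr_ge0 => i _; rewrite -expr2 sqr_ge0. Qed.

Lemma dot_eq0 (R : realType) (d : nat) (u : 'cV[R]_d) :
  dot u u = 0 -> u = 0.
Proof.
move=> /eqP; rewrite psumr_eq0 => [/allP u0|i _]; last by rewrite -expr2 sqr_ge0.
apply/colP => i; rewrite mxE; apply/eqP; rewrite -sqrf_eq0 expr2.
exact: (u0 i (mem_index_enum i)).
Qed.

Lemma sqr_enorm (R : realType) (d : nat) (u : 'cV[R]_d) :
  enorm u ^+ 2 = dot u u.
Proof. by rewrite sqr_sqrtr ?dot_ge0. Qed.

Lemma dot_symmetric (R : realType) (d : nat) (A : 'M[R]_d) (u v : 'cV[R]_d) :
  A^T = A -> dot u (A *m v) = dot (A *m u) v.
Proof. by move=> symA; rewrite !dotE trmx_mul symA mulmxA. Qed.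

(** A zero of a nonnegative quadratic form is a minimum, so the gradient
    [2 A r] vanishes there. *)
Lemma psd_dot_eq0 (R : realType) (d : nat) (A : 'M[R]_d) (r : 'cV[R]_d) :
  A^T = A -> (forall v, 0 <= dot v (A *m v)) -> dot r (A *m r) = 0 ->
  A *m r = 0.
Proof.
move=> symA psd rAr; apply: dot_eq0.
set y := A *m r; set N := dot y y; set M := dot y (A *m y).
have M1_gt0 : 0 < M + 1 by rewrite ltr_wpDl ?psd.
(* Moving from [r] against the gradient by N / (M + 1) makes the form
   negative unless [N = 0]; scaling by [M + 1] avoids the division. *)
have := psd ((M + 1) *: r - N *: y).
have -> : dot ((M + 1) *: r - N *: y) (A *m ((M + 1) *: r - N *: y))
          = - N ^+ 2 * (M + 2).
  rewrite mulmxBr -!scalemxAr !(dotBl, dotBr, dotZl, dotZr) rAr -/y -/M -/N.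
  by rewrite (dot_symmetric r y symA) -/y -/N; ring.
rewrite mulNr oppr_ge0 pmulr_lle0; last by rewrite ltr_wpDl ?psd.
by move=> N2_le0; apply/eqP; rewrite -sqrf_eq0 eq_le N2_le0 sqr_ge0.
Qed.

Lemma not_indefinite_dot_eq0 (R : realType) (d : nat) (A : 'M[R]_d)
    (r : 'cV[R]_d) :
  A^T = A -> ~ indefinite A -> dot r (A *m r) = 0 -> A *m r = 0.
Proof.
move=> symA nindef rAr.
have [[v v_lt0]|nneg] := EM (exists v, dot v (A *m v) < 0); last first.
  apply: psd_dot_eq0 => // v; rewrite leNgt; apply/negP => v_lt0.
  by apply: nneg; exists v.
apply/eqP; rewrite -oppr_eq0 -mulNmx; apply/eqP; apply: psd_dot_eq0.
- by rewrite linearN /= symA.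
- move=> u; rewrite mulNmx dotNr oppr_ge0 leNgt; apply/negP => u_gt0.
  by apply: nindef; split; [exists u | exists v].
- by rewrite mulNmx dotNr rAr oppr0.
Qed.

(** * Krylov spaces *)

Lemma mem_krylov (R : realType) (d : nat) (A : 'M[R]_d) (b : 'cV[R]_d) k i :
  (i < k)%N -> A ^+ i *m b \in krylov A b k.
Proof.
by move=> ik; apply/memv_span/mapP; exists i; rewrite // mem_iota add0n.
Qed.

Lemma krylov_subvP (R : realType) (d : nat) (A : 'M[R]_d) (b : 'cV[R]_d) k
    (U : {vspace 'cV[R]_d}) :
  (forall i, (i < k)%N -> A ^+ i *m b \in U) -> (krylov A b k <= U)%VS.
Proof.
move=> bU; apply/span_subvP => _ /mapP[i + ->].
by rewrite mem_iota add0n => /andP[_ /bU].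
Qed.

Lemma krylov_leq (R : realType) (d : nat) (A : 'M[R]_d) (b : 'cV[R]_d) k l :
  (k <= l)%N -> (krylov A b k <= krylov A b l)%VS.
Proof.
move=> kl; apply: krylov_subvP => i ik; apply: mem_krylov.
exact: leq_trans ik kl.
Qed.

Lemma expmx_shift (R : realType) (d : nat) (A : 'M[R]_d) (b : 'cV[R]_d) i :
  A ^+ i *m (A *m b) = A ^+ i.+1 *m b.
Proof. by rewrite exprSr -mulmxE mulmxA. Qed.

Lemma krylovS (R : realType) (d : nat) (A : 'M[R]_d) (b : 'cV[R]_d) k :
  krylov A b k.+1 = (<[b]> + krylov A (A *m b) k)%VS.
Proof.
rewrite /krylov /= span_cons expr0 mul1mx (iotaDl 1 0) -map_comp.
by congr (_ + <<_>>)%VS; apply: eq_map => i /=; rewrite expmx_shift.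
Qed.

Lemma mulmx_subv (R : realType) (d : nat) (A : 'M[R]_d) (X : seq 'cV[R]_d)
    (U : {vspace 'cV[R]_d}) :
  (forall v, v \in X -> A *m v \in U) ->
  forall v, v \in <<X>>%VS -> A *m v \in U.
Proof.
move=> XU v Xv; pose f := linfun (mulmx A : 'cV[R]_d -> 'cV[R]_d).
have : (<<X>> <= f @^-1: U)%VS.
  by apply/span_subvP => w /XU; rewrite -memv_preim lfunE.
by move=> /subvP/(_ v Xv); rewrite -memv_preim lfunE.
Qed.

Lemma mulmx_krylov (R : realType) (d : nat) (A : 'M[R]_d) (b v : 'cV[R]_d) k :
  v \in krylov A b k -> A *m v \in krylov A (A *m b) k.
Proof.
apply: mulmx_subv => _ /mapP[i + ->]; rewrite mem_iota add0n => /andP[_ ik].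
by rewrite mulmxA mulmxE -exprS -expmx_shift mem_krylov.
Qed.

Lemma krylov_range (R : realType) (d : nat) (A : 'M[R]_d) (b v : 'cV[R]_d) k :
  v \in krylov A (A *m b) k -> in_range A v.
Proof.
move=> v_in; pose f := linfun (mulmx A : 'cV[R]_d -> 'cV[R]_d).
have : v \in limg f.
  apply: (subvP _ _ v_in); apply: krylov_subvP => i _.
  rewrite expmx_shift exprS -mulmxE -mulmxA.
  by rewrite -[A *m _](lfunE (mulmx A : 'cV[R]_d -> 'cV[R]_d)) memv_img ?memvf.
by move=> /memv_imgP[x _]; rewrite lfunE => ->; exists x.
Qed.

Lemma dot_span_eq0 (R : realType) (d : nat) (u : 'cV[R]_d)
    (X : seq 'cV[R]_d) :
  (forall v, v \in X -> dot u v = 0) -> forall v, v \in <<X>>%VS -> dot u v = 0.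
Proof.
move=> uX v Xv; pose f := linfun (mulmx u^T : 'cV[R]_d -> 'cV[R]_1).
have : (<<X>> <= lker f)%VS.
  apply/span_subvP => w /uX uw; rewrite memv_ker lfunE /=.
  by apply/eqP/rowP => i; rewrite (ord1 i) -dotE uw mxE.
move=> /subvP/(_ v Xv); rewrite memv_ker lfunE /= => /eqP uv0.
by rewrite dotE uv0 mxE.
Qed.

(** The image of [K_(n+1)] lies in [K_(n+2) = K_(n+1)], the sum of the line
    of [b] and of [A K_n]. As it consists of vectors of the range, which contains
    [A K_n] but not [b], the component along [b] is zero. *)
Lemma krylov_stationary_range (R : realType) (d : nat) (A : 'M[R]_d)
    (b v : 'cV[R]_d) n :
  ~ in_range A b -> (krylov A b n.+2 <= krylov A b n.+1)%VS ->
  v \in krylov A b n.+1 -> A *m v \in krylov A (A *m b) n.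
Proof.
move=> bNrange stat v_in; set V := krylov A (A *m b) n.
have : A *m v \in krylov A b n.+1.
  apply: (subvP stat); rewrite krylovS; apply: (subvP (addvSr _ _)).
  exact: mulmx_krylov.
rewrite krylovS => /memv_addP[_ /vlineP[c ->] [w Vw Av]].
have [c0|c_neq0] := eqVneq c 0; first by rewrite Av c0 scale0r add0r.
have [y wE] := krylov_range Vw.
case: bNrange; exists (c^-1 *: (v - y)).
by rewrite -scalemxAr mulmxBr wE Av addrK scalerA mulVf ?scale1r.
Qed.

(** * The conjugate residual recurrences *)

Section Recurrences.

Variables (R : realType) (d : nat) (A : 'M[R]_d) (b : 'cV[R]_d).
Local Notation r k := (cr_r (cr A b k)).
Local Notation p k := (cr_p (cr A b k)).

Definition cr_alpha k : R := dot (r k) (A *m r k) / dot (A *m p k) (A *m p k).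

Definition cr_beta k : R :=
  dot (r k.+1) (A *m r k.+1) / dot (r k) (A *m r k).

Lemma cr_rS k : r k.+1 = r k - cr_alpha k *: (A *m p k).
Proof.
by rewrite /cr_alpha -sqr_enorm /cr /= /cr_step; case: (iter _ _ _).
Qed.

Lemma cr_pS k : p k.+1 = r k.+1 + cr_beta k *: p k.
Proof.
by rewrite /cr_beta /cr /= /cr_step; case: (iter _ _ _).
Qed.

(** The first half says that the polynomial expressing [r k] has constant
    coefficient 1 and degree at most [k]. *)
Lemma cr_krylov k :
  r k - b \in krylov A (A *m b) k /\ p k \in krylov A b k.+1.
Proof.
elim: k => [|k [IHr IHp]].
  by rewrite /= subrr mem0v; split=> //; rewrite krylovS memvE addvSl.
have rk : r k.+1 - b \in krylov A (A *m b) k.+1.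
  rewrite cr_rS addrAC rpredB ?rpredZ ?mulmx_krylov //.
  exact: subvP (krylov_leq _ _ (leqnSn k)) _ IHr.
split=> //; rewrite cr_pS rpredD ?rpredZ //; last first.
  exact: subvP (krylov_leq _ _ (leqnSn k.+1)) _ IHp.
by rewrite -[r k.+1](subrK b) addrC krylovS memv_add ?memv_line.
Qed.

Lemma cr_generated_leq k l :
  (k <= l)%N -> cr_generated A b l -> cr_generated A b k.
Proof. by move=> kl gen j jk; apply: gen; apply: leq_trans jk kl. Qed.

(** Since the step length is nonzero, the update of the residual can be solved
    for [A *m p k]; this is how [A] is applied to the search directions both in
    the conjugacy proof and in [krylov_directions]. *)
Lemma cr_generated_rS k : cr_generated A b k.+1 ->
  A *m p k = (cr_alpha k)^-1 *: (r k - r k.+1).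
Proof.
move=> /(_ k (ltnSn k)); rewrite sqr_enorm => -[/eqP pp /eqP rr].
rewrite cr_rS subKr scalerA mulVf ?scale1r //.
by rewrite mulf_neq0 ?invr_eq0.
Qed.

(** Passing from [k] to [k + 1]: since [<r k, A p k> = <r k, A r k>], the step
    length projects out the component of the residual along [A p k], and the new
    residual keeps its orthogonality to the older [A p i]. The coefficient
    [cr_beta k] is chosen to make the second relation hold for [i = k], and the
    older directions come for free from the symmetry of [A]. The third relation
    also ensures that [A p k] is nonzero as soon as [<r k, A r k>] is. *)
Lemma cr_orthogonality k : A^T = A -> cr_generated A b k ->
  [/\ forall i, (i < k)%N -> dot (r k) (A *m p i) = 0,
      forall i, (i < k)%N -> dot (A *m p k) (A *m p i) = 0
    & dot (r k) (A *m p k) = dot (r k) (A *m r k)].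
Proof.
move=> symA; elim: k => [//|k IHk] gen.
have [IHr IHp IHd] := IHk (cr_generated_leq (leqnSn k) gen).
have [/eqP] := gen k (ltnSn k); rewrite sqr_enorm => pp /eqP rr.
have rAp i : (i < k.+1)%N -> dot (r k.+1) (A *m p i) = 0.
  rewrite ltnS leq_eqVlt cr_rS dotBl dotZl => /orP[/eqP->|ik].
    by rewrite IHd divfK ?subrr.
  by rewrite IHr ?IHp // mulr0 subr0.
(* The residuals are [A]-orthogonal: each [r i] is a combination of [p i] and
   [p (i - 1)]. *)
have rAr i : (i < k.+1)%N -> dot (A *m r k.+1) (r i) = 0.
  rewrite -dot_symmetric //; case: i => [|i] ik; first exact: (rAp 0%N).
  have -> : r i.+1 = p i.+1 - cr_beta i *: p i by rewrite cr_pS addrK.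
  by rewrite mulmxBr -scalemxAr dotBr dotZr !rAp ?(ltnW ik) // mulr0 subrr.
split=> // [i|]; last first.
  by rewrite [in LHS]cr_pS mulmxDr -scalemxAr dotDr dotZr rAp // mulr0 addr0.
rewrite cr_pS mulmxDr -scalemxAr dotDl dotZl ltnS leq_eqVlt.
case/orP=> [/eqP->|ik].
  rewrite {1}(cr_generated_rS gen) dotZr dotBr rAr //.
  rewrite -dot_symmetric // /cr_alpha /cr_beta.
  by field; apply/andP; split.
rewrite (IHp i ik) cr_generated_rS; last exact: cr_generated_leq (leqW ik) gen.
by rewrite dotZr dotBr !rAr ?subr0 ?mulr0 ?addr0 ?ltnS // ltnW.
Qed.

Definition cr_directions k : {vspace 'cV[R]_d} :=
  <<[seq p i | i <- iota 0 k]>>%VS.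

Lemma mem_cr_directions k i : (i < k)%N -> p i \in cr_directions k.
Proof.
by move=> ik; apply/memv_span/mapP; exists i; rewrite // mem_iota add0n.
Qed.

Lemma cr_r_directions k i : (i < k)%N -> r i \in cr_directions k.
Proof.
case: i => [|i] ik; first exact: (mem_cr_directions ik).
have -> : r i.+1 = p i.+1 - cr_beta i *: p i by rewrite cr_pS addrK.
by rewrite rpredB ?rpredZ ?mem_cr_directions // ltnW.
Qed.

(** By [cr_generated_rS], [A *m p j] is a combination of [r j] and [r j.+1], hence
    of the directions of index at most [j + 1]: multiplication by [A] extends the
    span of the directions by at most one step, as it does for Krylov spaces. *)
Lemma krylov_directions k : cr_generated A b k ->
  (krylov A b k.+1 <= cr_directions k.+1)%VS.
Proof.
elim: k => [|k IHk] gen.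
  apply: krylov_subvP => -[|//] _; rewrite expr0 mul1mx.
  exact: (@mem_cr_directions 1 0).
have {}IHk := subvP (IHk (cr_generated_leq (leqnSn k) gen)).
apply: krylov_subvP => -[|i] ik.
  by rewrite expr0 mul1mx; apply: (@mem_cr_directions k.+2 0).
(* The induction hypothesis only spans [A^i b] by the directions up to [k], so
   that their images under [A] stay within the directions up to [k + 1]. *)
rewrite exprS -mulmxE -mulmxA.
apply: (mulmx_subv _ (IHk _ (mem_krylov A b (ik : (i < k.+1)%N)))).
move=> _ /mapP[j + ->].
rewrite mem_iota add0n => /andP[_ jk].
rewrite cr_generated_rS ?rpredZ ?rpredB ?cr_r_directions //.
  exact: ltnW.
exact: cr_generated_leq jk gen.
Qed.

End Recurrences.

(** * The residual becomes a null vector exactly at the grade *)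

(** If [A r_k = 0], the constant coefficient 1 makes [A b] a combination of
    [A^2 b, ..., A^(k+1) b], a redundant generator of [K_(k+2)]. *)
Lemma cr_residual_neq0 (R : realType) (d : nat) (A : 'M[R]_d) (b : 'cV[R]_d) k :
  \dim (krylov A b k.+2) = k.+2 -> A *m cr_r (cr A b k) <> 0.
Proof.
move=> dimK Ar0; have [/mulmx_krylov + _] := cr_krylov A b k.
rewrite mulmxBr Ar0 sub0r rpredN => Ab_in.
have : (\dim (krylov A b k.+2) <= k.+1)%N; last by rewrite dimK ltnn.
rewrite krylovS [krylov A (A *m b) _]krylovS.
rewrite [(<[A *m b]> + _)%VS](addv_idPr _) //.
apply: leq_trans (dimv_add_leqif _ _) _; rewrite dim_vline -(add1n k).
apply: leq_add; first exact: leq_b1.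
apply: leq_trans (dim_span _) _.
by rewrite size_map size_iota.
Qed.

(** The residual is orthogonal to [V := A K_n], which contains [A r] and is
    stable under [A], so that [|A r|^2 = <r, A (A r)> = 0]. *)
Lemma cr_residual_eq0 (R : realType) (d : nat) (A : 'M[R]_d) (b : 'cV[R]_d) n :
  A^T = A -> ~ in_range A b -> (krylov A b n.+2 <= krylov A b n.+1)%VS ->
  cr_generated A b n -> A *m cr_r (cr A b n) = 0.
Proof.
move=> symA bNrange stat gen; set r := cr_r (cr A b n).
have AV := krylov_stationary_range bNrange stat.
have r_perp v : v \in krylov A (A *m b) n -> dot r v = 0.
  case: n {stat AV} @r gen => [|n] r gen.
    by rewrite /krylov /= span_nil memv0 => /eqP->; rewrite dot0r.
  have [rAp _ _] := cr_orthogonality symA gen.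
  apply: dot_span_eq0 => _ /mapP[i + ->]; rewrite mem_iota add0n => /andP[_ ik].
  rewrite expmx_shift exprS -mulmxE -mulmxA dot_symmetric //.
  have := subvP (krylov_directions (cr_generated_leq (leqnSn n) gen)) _
    (mem_krylov A b ik).
  apply: dot_span_eq0 => _ /mapP[j + ->]; rewrite mem_iota => /andP[_ jk].
  by rewrite -dot_symmetric //; apply: rAp.
have sub : (krylov A (A *m b) n <= krylov A b n.+1)%VS.
  by rewrite krylovS addvSr.
have rK : r \in krylov A b n.+1.
  have [rb _] := cr_krylov A b n.
  by rewrite -[r](subrK b) addrC krylovS memv_add ?memv_line.
apply: dot_eq0; rewrite -dot_symmetric //; apply: r_perp.
exact: AV _ (subvP sub _ (AV _ rK)).
Qed.

Theorem theorem3 (R : realType) (d : nat) (A : 'M[R]_d) (b : 'cV[R]_d)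
    (g : nat)
    (symA : A^T = A)
    (b_notin_range : ~ in_range A b)
    (grade_g : is_grade A b g)
    (no_breakdown : no_unlucky_breakdown A b) :
  forall k : nat, (1 <= k <= g)%N ->
    cr_generated A b k.-1 /\
    (A *m cr_r (cr A b k.-1) = 0 <-> k = g).
Proof.
have [g_gt0 dim_le dim_gt] := grade_g.
have Ar_neq0 j : (j.+1 < g)%N -> A *m cr_r (cr A b j) <> 0.
  by move=> jg; apply: cr_residual_neq0; apply: dim_le.
have gen k : (k < g)%N -> cr_generated A b k.
  elim: k => [//|k IHk] kg; have genk := IHk (ltnW kg) => j.
  rewrite ltnS leq_eqVlt => /orP[/eqP->|/genk //].
  have Ark := Ar_neq0 k kg.
  have rAr : dot (cr_r (cr A b k)) (A *m cr_r (cr A b k)) <> 0.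
    move=> rAr0; have [indef|nindef] := EM (indefinite A); last first.
      exact/Ark/not_indefinite_dot_eq0.
    apply: (no_breakdown indef); exists k; split=> // r0.
    by apply: Ark; rewrite r0 mulmx0.
  split=> //; rewrite sqr_enorm => /dot_eq0 Ap0; apply: rAr.
  have [_ _ <-] := cr_orthogonality symA genk.
  by rewrite Ap0 dot0r.
case=> [//|n] /= ng; split; first exact: gen.
split=> [Ar0|gE].
  apply/eqP; rewrite eqn_leq ng leqNgt /=; apply/negP => /Ar_neq0.
  exact.
apply: cr_residual_eq0 => //; last exact: gen.
have /eqP <- : krylov A b n.+1 == krylov A b n.+2.
  by rewrite eqEdim krylov_leq //= gE dim_gt // dim_le // g_gt0 /=.
exact: subvv.
Qed.
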